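(* For every integer $m\ge 1$, all real numbers $0<x_1<\cdots<x_m$ and all real numbers $0\le s_1<\cdots<s_m$, one has $$\det[I_{s_j}(x_i)]_{i,j=1}^m>0,$$ where $I_s$ denotes the modified Bessel function of the first kind of order $s$. Equivalently, the kernel $K(x,s)=I_s(x)$ is strictly totally positive of infinite order ($\mathrm{STP}_\infty$) on $(0,\infty)\times[0,\infty)$.
   Context: For real $s\ge 0$ and $x>0$, the modified Bessel function of the first kind is $$I_s(x)=\sum_{k=0}^\infty \frac{1}{k!\,\Gamma(s+k+1)}\left(\frac{x}{2}\right)^{s+2k}.$$ A kernel $K:X\times Y\to\mathbb{R}$ on totally ordered sets $X,Y$ is strictly totally positive of infinite order, written $\mathrm{STP}_\infty$, if $\det[K(x_i,y_j)]_{i,j=1}^m>0$ for every $m\ge1$ and every $x_1<\cdots<x_m$ in $X$ and $y_1<\cdots<y_m$ in $Y$. *)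

(* Defs.v *)
From HB Require Import structures.
From mathcomp Require Import all_boot all_order all_algebra.
From mathcomp Require Import all_classical all_reals all_analysis.

Set Implicit Arguments.
Unset Strict Implicit.
Unset Printing Implicit Defensive.

Import Order.TTheory GRing.Theory Num.Theory.
Import numFieldNormedType.Exports.

Local Open Scope classical_set_scope.
Local Open Scope ring_scope.

(* Euler's integral, which represents the Gamma function for 0 < z only.
   [besselI] below only evaluates it at s + k + 1 with 0 <= s. *)
Definition Gamma (R : realType) (z : R) : R :=
  Rintegral lebesgue_measure `]0, +oo[ (fun t : R => t `^ (z - 1) * expR (- t)).

Definition besselI (R : realType) (s x : R) : R :=
  limn (series (fun k : nat =>
    (k`!%:R * Gamma (s + k%:R + 1))^-1 * (x / 2) `^ (s + (2 * k)%:R))).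

(* The totally ordered index sets are subsets X, Y of totally ordered types. *)
Definition STPoo (R : realType) (d1 d2 : Order.disp_t)
    (T : orderType d1) (U : orderType d2)
    (X : set T) (Y : set U) (K : T -> U -> R) : Prop :=
  forall (m : nat) (x : 'I_m -> T) (y : 'I_m -> U),
    (1 <= m)%N ->
    (forall i, X (x i)) -> (forall i, Y (y i)) ->
    (forall i j : 'I_m, (i < j)%N -> (x i < x j)%O) ->
    (forall i j : 'I_m, (i < j)%N -> (y i < y j)%O) ->
    0 < \det (\matrix_(i < m, j < m) K (x i) (y j)).

(* Main.v *)
Require Import Defs.
From HB Require Import structures.
From mathcomp Require Import all_boot all_order all_algebra.
From mathcomp Require Import all_classical all_reals all_analysis.
From mathcomp Require Import measurable_realfun.
From mathcomp Require Import ring lra.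

Set Implicit Arguments.
Unset Strict Implicit.
Unset Printing Implicit Defensive.

Import Order.TTheory GRing.Theory Num.Theory.
Import numFieldNormedType.Exports.

Local Open Scope classical_set_scope.
Local Open Scope ring_scope.

(* Put y = (x / 2)^2 and p = s / 2.  Up to the positive factor 1 / Gamma(s + 1),
   I_s(x) is phi_s(y) = y^p f_s(y) with f_s entire and f_s(0) = 1, and for
   theta = y d/dy one has theta^2 phi_s = (y + p^2) phi_s.  Hence the logarithmic
   derivatives a_s = theta phi_s / phi_s satisfy the Riccati equations
   theta a + a^2 = V + p^2 with a common potential V, and a_s -> p at 0.
   For such a family p_0 < p_1 < ..., the Wronskian phi_0 phi_j (a_j - a_0) has
   theta-derivative (p_j^2 - p_0^2) phi_0 phi_j > 0 and vanishes at 0, so it is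
   positive.  The Darboux transforms psi_j = phi_j (a_j - a_0), j > 0, therefore
   form a family of the same kind, with one function less.  Dividing the rows of
   det [phi_j(y_i)] by phi_0(y_i), subtracting consecutive rows and applying the
   mean value theorem in each row turns this determinant into a positive multiple
   of det [psi_j(xi_i)] with xi_i in (y_i, y_(i+1)), and induction applies. *)

(** * Determinants: consecutive row differences and mean values row by row *)

(** Left multiplication by the unitriangular [L] subtracts from each row its predecessor. The first
    column becomes the first basis vector, and expansion along it leaves the minor of
    differences. *)
Lemma det_col1_row_differences (R : comNzRingType) (n : nat)
    (M : 'M[R]_n.+1) :
  (forall i, M i ord0 = 1) ->
  \det M = \det (\matrix_(i < n, j < n)
    (M (lift ord0 i) (lift ord0 j) - M (widen_ord (leqnSn n) i) (lift ord0 j))).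
Proof.
move=> M1.
pose L : 'M[R]_n.+1 :=
  \matrix_(i, j) ((i == j)%:R - (val i == (val j).+1)%:R).
have LME i j : (L *m M) i j = M i j - (if unlift ord0 i is Some k
    then M (widen_ord (leqnSn n) k) j else 0).
  rewrite mxE; under eq_bigr do rewrite mxE mulrBl.
  rewrite sumrB; congr (_ - _).
    rewrite (bigD1 i)//= eqxx mul1r big1 ?addr0// => k ki.
    by rewrite eq_sym (negPf ki) mul0r.
  case: unliftP => [k ->|->].
    rewrite (bigD1 (widen_ord (leqnSn n) k))//= eqxx mul1r big1 ?addr0// => l lk.
    rewrite /bump/= add1n eqSS eq_sym.
    by rewrite (_ : (_ == _ :> nat) = false) ?mul0r//; apply/negbTE.
  by rewrite big1// => l _; rewrite mul0r.
have <- : \det (L *m M) = \det M.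
  rewrite det_mulmx det_trig.
    rewrite big1 ?mul1r// => i _; rewrite mxE eqxx.
    by rewrite (_ : (_ == _ :> nat) = false) ?subr0//= ltn_eqF.
  apply/is_trig_mxP => i j ij; rewrite mxE.
  rewrite (_ : (i == j) = false); last by rewrite -val_eqE/= ltn_eqF.
  by rewrite (_ : (_ == _ :> nat) = false) ?subr0//= ltn_eqF// ltnS ltnW.
rewrite (expand_det_col _ ord0) (bigD1 ord0)//= big1 ?addr0; last first.
  move=> i; case: (unliftP ord0 i) => [k ->|->]; last by rewrite eqxx.
  by move=> _; rewrite LME liftK !M1 subrr mul0r.
rewrite LME unlift_none M1 subr0 mul1r /cofactor/= expr0 mul1r.
congr (\det _); apply/matrixP => i j.
by rewrite [LHS]mxE [LHS]mxE LME liftK [RHS]mxE.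
Qed.

Lemma det_scale_rows (R : comNzRingType) (n : nat) (c : 'I_n -> R)
    (M : 'I_n -> 'I_n -> R) :
  \det (\matrix_(i, j) (c i * M i j)) = \prod_i c i * \det (\matrix_(i, j) M i j).
Proof.
have -> : \matrix_(i, j) (c i * M i j) =
    diag_mx (\row_j c j) *m \matrix_(i, j) M i j.
  by apply/matrixP => i j; rewrite mul_diag_mx !mxE.
by rewrite det_mulmx det_diag; congr (_ * _); apply: eq_bigr => i _; rewrite mxE.
Qed.

(* The determinant is affine in each row, so the mean value theorem can be
   applied to one row at a time; [k] counts the rows already treated. *)
Lemma det_mean_value (R : realType) (n : nat) (g dg : 'I_n -> R -> R)
    (u v : 'I_n -> R) :
  (forall i, u i < v i) ->
  (forall i j (t : R), u i <= t <= v i -> is_derive t 1 (g j) (dg j t)) ->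
  exists xi : 'I_n -> R, (forall i, u i < xi i < v i) /\
    \det (\matrix_(i, j) (g j (v i) - g j (u i))) =
    \prod_i (v i - u i) * \det (\matrix_(i, j) dg j (xi i)).
Proof.
move=> uv gdg.
suff H (k : nat) : (k <= n)%N -> exists xi : 'I_n -> R,
    (forall i, u i < xi i < v i) /\
    \det (\matrix_(i, j) (g j (v i) - g j (u i))) =
    \prod_(i < n | (i < k)%N) (v i - u i) *
    \det (\matrix_(i, j) (if (i < k)%N then dg j (xi i)
                          else g j (v i) - g j (u i))).
  have [xi [xiuv ->]] := H n (leqnn n); exists xi; split => //; congr (_ * _).
    by apply: eq_bigl => i; rewrite ltn_ord.
  by congr (\det _); apply/matrixP => i j; rewrite !mxE ltn_ord.
elim: k => [_|k IH kn].
  (* As long as no row is treated, any interior point will do. *)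
  exists (fun i => (u i + v i) / 2); split.
    by move=> i; rewrite midf_lt// midf_lt.
  by rewrite big_pred0// mul1r.
have [xi [xiuv ->]] := IH (ltnW kn).
pose i0 : 'I_n := Ordinal kn.
pose A (r : 'I_n -> R) : 'M[R]_n := \matrix_(i, j)
  (if i == i0 then r j else if (i < k)%N then dg j (xi i)
                            else g j (v i) - g j (u i)).
(* Cofactors along row [i0] do not see the contents of that row, so they can be computed with a zero
   row. *)
pose c j := cofactor (A (fun=> 0)) i0 j.
have detA r : \det (A r) = \sum_j r j * c j.
  rewrite (expand_det_row _ i0); apply: eq_bigr => j _; rewrite mxE eqxx.
  congr (_ * _); rewrite /c /cofactor; congr (_ * \det _).
  by apply/matrixP => i l; rewrite !mxE eq_sym (negPf (neq_lift _ _)).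
(* The determinant is the increment of this single scalar function, so one point [t] serves all
   columns of row [i0]. *)
pose F t := \sum_j c j * g j t.
pose dF t := \sum_j c j * dg j t.
have FdF t : u i0 <= t <= v i0 -> is_derive t 1 F (dF t).
  move=> tuv; rewrite /F /dF.
  have -> : (fun t => \sum_j c j * g j t) = \sum_j (c j *: g j).
    by apply/funext => z; rewrite fct_sumE.
  apply: is_derive_sum => j; apply: is_deriveZ; exact: gdg tuv.
have [t tuv FE] : exists2 t, t \in `]u i0, v i0[%R &
    F (v i0) - F (u i0) = dF t * (v i0 - u i0).
  apply: MVT => //.
    by move=> t; rewrite in_itv/= => /andP[/ltW ut /ltW tv]; apply: FdF; rewrite ut.
  apply: derivable_within_continuous => t; rewrite in_itv/= => /FdF h.
  exact: ex_derive.
exists (fun i => if i == i0 then t else xi i); split.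
  by move=> i; case: eqVneq => [->|//]; move: tuv; rewrite in_itv.
rewrite [in RHS](bigD1 i0)//=.
under [in RHS]eq_bigl => i do rewrite ltnS andbC -ltn_neqAle.
rewrite [in RHS]mulrAC [RHS]mulrC; congr (_ * _).
transitivity (\det (A (fun j => g j (v i0) - g j (u i0)))).
  congr (\det _); apply/matrixP => i j; rewrite !mxE.
  by case: eqVneq => [->|//]; rewrite ltnn.
transitivity (\det (A (fun j => dg j t)) * (v i0 - u i0)); last first.
  rewrite mulrC; congr (_ * \det _); apply/matrixP => i j; rewrite !mxE.
  case: (eqVneq i i0) => [->|ii0]; first by rewrite ltnSn.
  by rewrite ltnS [(i <= k)%N]leq_eqVlt -[_ == k]/(i == i0) (negPf ii0).
rewrite !detA; transitivity (F (v i0) - F (u i0)).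
  by rewrite /F -sumrB; apply: eq_bigr => j _; ring.
by rewrite FE; congr (_ * _); apply: eq_bigr => j _; rewrite mulrC.
Qed.

(** * Riccati systems and their Darboux transforms *)

(* [a j] is the logarithmic derivative of [phi j] for the derivation [y * d/dy];
   the third clause says that [phi j] is an eigenfunction of
   [(y * d/dy)^2 - V] with eigenvalue [p j ^+ 2]. *)
Definition riccati_system (R : realType) (n : nat) (V : R -> R)
    (p : 'I_n -> R) (phi a : 'I_n -> R -> R) : Prop :=
  [/\ forall j y, 0 < y -> 0 < phi j y,
      forall j (y : R), 0 < y -> is_derive y 1 (phi j) (a j y * phi j y / y),
      forall j (y : R), 0 < y ->
        is_derive y 1 (a j) ((V y + p j ^+ 2 - a j y ^+ 2) / y),
      forall j, a j y @[y --> 0^'+] --> p j &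
      forall i j, i != j -> phi i y * phi j y @[y --> 0^'+] --> (0 : R)].

(** By the mean value theorem [f] is strictly increasing. Passing through [y / 2] keeps the
    inequality strict: the limit only gives [0 <= f (y / 2)]. *)
Lemma gt0_of_derive_gt0 (R : realType) (f df : R -> R) :
  (forall y : R, 0 < y -> is_derive y 1 f (df y)) ->
  (forall y, 0 < y -> 0 < df y) ->
  f y @[y --> 0^'+] --> (0 : R) ->
  forall y, 0 < y -> 0 < f y.
Proof.
move=> fdf df0 f0.
have incr x y : 0 < x -> x < y -> f x < f y.
  move=> x0 xy; rewrite -subr_gt0.
  have [||c cxy ->] := @MVT R f df x y xy.
  - by move=> z; rewrite in_itv/= => /andP[xz _]; apply: fdf; exact: lt_trans xz.
  - apply: derivable_within_continuous => z; rewrite in_itv/= => /andP[xz _].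
    by have h := fdf _ (lt_le_trans x0 xz); exact: ex_derive.
  - rewrite mulr_gt0 ?subr_gt0// df0//; move: cxy; rewrite in_itv/= => /andP[+ _].
    exact: lt_trans.
move=> y y0; apply: (@le_lt_trans _ _ (f (y / 2))); last first.
  by apply: incr; rewrite ?divr_gt0// ltr_pdivrMr// ltr_pMr// ltr1n.
apply: (@cvgr_to_le _ _ _ _ _ _ _ f0); near=> z; apply/ltW/incr.
  by near: z; exact: nbhs_right_gt.
by near: z; apply: nbhs_right_lt; rewrite divr_gt0.
Unshelve. all: by end_near. Qed.

Section darboux.
Variables (R : realType) (n : nat) (V : R -> R) (p : 'I_n.+1 -> R).
Variables (phi a : 'I_n.+1 -> R -> R).
Hypothesis p_ge0 : forall i, 0 <= p i.
Hypothesis p_incr : forall i j : 'I_n.+1, (i < j)%N -> p i < p j.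
Hypothesis sys : riccati_system V p phi a.

Let D j := p (lift ord0 j) ^+ 2 - p ord0 ^+ 2.
Let d j y := a (lift ord0 j) y - a ord0 y.

Let D_gt0 j : 0 < D j.
Proof. by rewrite subr_gt0 ltr_pXn2r ?nnegrE// p_incr. Qed.

(** Subtracting two Riccati equations cancels the potential, and the difference of squares leaves an
    equation linear in [d j] up to the constant [D j]. *)
Let d_derive j (y : R) : 0 < y -> is_derive y 1 (d j)
  ((D j - d j y * (a (lift ord0 j) y + a ord0 y)) / y).
Proof.
case: sys => _ _ da _ _ y0.
have h1 := da ord0 y y0; have h2 := da (lift ord0 j) y y0.
rewrite /d; apply: is_derive_eq; rewrite /D; ring.
Qed.

Let d_gt0 j (y : R) : 0 < y -> 0 < d j y.
Proof.
case: sys => phi0 dphi da ap phiphi y0.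
(* This product is the Wronskian of [phi ord0] and [phi (lift ord0 j)]. *)
have : 0 < phi ord0 y * phi (lift ord0 j) y * d j y.
  pose W := (phi ord0 * phi (lift ord0 j)) * d j.
  apply: (@gt0_of_derive_gt0 R W
    (fun y => phi ord0 y * phi (lift ord0 j) y * D j / y)) => //.
  (* The logarithmic derivatives of the two [phi] factors add up to the sum that damps [d j], so
     only the term in [D j] survives. *)
  - move=> z z0; have h1 := dphi ord0 z z0; have h2 := dphi (lift ord0 j) z z0.
    have h3 := d_derive j z0.
    rewrite /W; apply: is_derive_eq.
    rewrite /d /GRing.scale/= !fctE; field.
    by rewrite gt_eqF.
  - by move=> z z0; rewrite divr_gt0// !mulr_gt0// phi0.
  - rewrite -[X in _ --> X](mul0r (p (lift ord0 j) - p ord0)).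
    by apply: cvgM; [apply: phiphi|rewrite /d; apply: cvgB].
by rewrite pmulr_rgt0// mulr_gt0// phi0.
Qed.

(** Write theta for [y * d/dy]. The new logarithmic derivative is [a_j + theta d_j / d_j], which
    [d_derive] turns into [D_j / d_j - a_0]. The new potential is the Darboux potential
    [V - 2 theta a_0], with theta eliminated by the Riccati equation of [a_0]. *)
Lemma darboux_riccati_system :
  riccati_system (fun y => 2 * a ord0 y ^+ 2 - 2 * p ord0 ^+ 2 - V y)
    (fun j => p (lift ord0 j))
    (fun j y => phi (lift ord0 j) y * (a (lift ord0 j) y - a ord0 y))
    (fun j y => D j / d j y - a ord0 y).
Proof.
have /= d0 := d_gt0; have /= dd := d_derive; have /= D0 := D_gt0.
case: sys => phi0 dphi da ap phiphi; split.
- by move=> j y y0; rewrite mulr_gt0 ?phi0 ?d0.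
- move=> j y y0.
  have h1 := dphi (lift ord0 j) y y0; have h2 := dd j y y0.
  rewrite -[X in is_derive _ _ X _]/(phi (lift ord0 j) * d j).
  apply: is_derive_eq; rewrite /GRing.scale/= -/(d j y); have := d0 j y y0.
  rewrite /d => /lt0r_neq0 d1; field.
  by rewrite gt_eqF.
- move=> j y y0.
  have h1 := da ord0 y y0; have h2 := dd j y y0.
  rewrite -[X in is_derive _ _ X _]/(cst (D j) * (fun y => (d j y)^-1) - a ord0).
  have := lt0r_neq0 (d0 j y y0) => d1.
  have h3 := is_deriveV d1 h2.
  apply: is_derive_eq; rewrite /GRing.scale/=.
  move: d1; rewrite /D /d /= => d1; field.
  by rewrite d1 gt_eqF.
- move=> j; have pp : 0 < p (lift ord0 j) - p ord0 by rewrite subr_gt0 p_incr.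
  (* As [D j] is a difference of squares, the quotient is the sum of the two exponents: the
     transform preserves [p (lift ord0 j)]. *)
  rewrite (_ : p (lift ord0 j) = D j / (p (lift ord0 j) - p ord0) - p ord0).
    apply: cvgB => //; apply: cvgM; first exact: cvg_cst.
    by apply: cvgV; [rewrite gt_eqF|rewrite /d; apply: cvgB].
  by rewrite /D; field; rewrite gt_eqF.
- move=> i j ij.
  rewrite -[X in _ --> X](mul0r ((p (lift ord0 i) - p ord0) *
                                 (p (lift ord0 j) - p ord0))).
  rewrite (_ : (fun y => _) = (fun y =>
      (phi (lift ord0 i) y * phi (lift ord0 j) y) *
      ((a (lift ord0 i) y - a ord0 y) * (a (lift ord0 j) y - a ord0 y)))); last first.
    by apply/funext => y; ring.
  apply: cvgM; first by apply: phiphi; rewrite (inj_eq lift_inj).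
  by apply: cvgM; apply: cvgB.
Qed.

End darboux.

Lemma riccati_system_det_gt0 (R : realType) (n : nat) (V : R -> R)
    (p : 'I_n -> R) (phi a : 'I_n -> R -> R) (y : 'I_n -> R) :
  (forall i, 0 <= p i) -> (forall i j : 'I_n, (i < j)%N -> p i < p j) ->
  riccati_system V p phi a ->
  (forall i, 0 < y i) -> (forall i j : 'I_n, (i < j)%N -> y i < y j) ->
  0 < \det (\matrix_(i < n, j < n) phi j (y i)).
Proof.
(* Everything is generalized: the transform changes the potential and the functions, and the mean
   value theorem moves the points. *)
elim: n => [|n IH] in V p phi a y *; first by rewrite det_mx00 ltr01.
move=> p0 p_incr sys y0 y_incr.
have sys' := darboux_riccati_system p0 p_incr sys.
have [phi0 dphi _ _ _] := sys.
pose g j z := phi (lift ord0 j) z / phi ord0 z.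
pose psi (j : 'I_n) z := phi (lift ord0 j) z * (a (lift ord0 j) z - a ord0 z).
(* The factor in front of [psi j z] is independent of [j], so it can later be pulled out of its
   row. *)
have dg j (z : R) : 0 < z -> is_derive z 1 (g j) ((z * phi ord0 z)^-1 * psi j z).
  move=> z0; have h1 := dphi ord0 z z0; have h2 := dphi (lift ord0 j) z z0.
  have q0 := lt0r_neq0 (phi0 ord0 z z0).
  have h3 := is_deriveV q0 h1.
  rewrite -[X in is_derive _ _ X _]/(phi (lift ord0 j) * (fun y => (phi ord0 y)^-1)).
  apply: is_derive_eq; rewrite /GRing.scale/= /psi; field.
  by rewrite q0 gt_eqF.
have -> : \matrix_(i < n.+1, j < n.+1) phi j (y i) =
    \matrix_(i, j) (phi ord0 (y i) * (phi j (y i) / phi ord0 (y i))).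
  apply/matrixP => i j; rewrite !mxE mulrC mulfVK// gt_eqF//; exact: phi0.
rewrite det_scale_rows mulr_gt0//; first by apply: prodr_gt0 => i _; exact: phi0.
pose Q : 'M[R]_n.+1 := \matrix_(i, j) (phi j (y i) / phi ord0 (y i)).
rewrite -/Q det_col1_row_differences; last first.
  by move=> i; rewrite mxE divff// gt_eqF//; exact: phi0.
pose u (i : 'I_n) := y (widen_ord (leqnSn n) i); pose v i := y (lift ord0 i).
have uv i : u i < v i by exact: y_incr.
have [|xi [xiuv]] := @det_mean_value R n g
  (fun j z => (z * phi ord0 z)^-1 * psi j z) u v uv.
  by move=> i j t /andP[ut _]; apply: dg; apply: lt_le_trans ut; exact: y0.
have -> : \matrix_(i, j) (g j (v i) - g j (u i)) = \matrix_(i, j)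
    (Q (lift ord0 i) (lift ord0 j) -
     Q (widen_ord (leqnSn n) i) (lift ord0 j)).
  by apply/matrixP => i j; rewrite !mxE.
move=> ->.
have xi0 i : 0 < xi i.
  by have /andP[+ _] := xiuv i; apply: lt_trans; exact: y0.
rewrite det_scale_rows !mulr_gt0//.
- by apply: prodr_gt0 => i _; rewrite subr_gt0.
- by apply: prodr_gt0 => i _; rewrite invr_gt0 mulr_gt0// phi0.
apply: IH sys' _ _ => //.
- by move=> i j ij; exact: p_incr.
(* The open intervals containing the [xi i] share at most endpoints, so the new points are again
   strictly increasing. *)
move=> i j ij; have /andP[_ h1] := xiuv i; have /andP[h2 _] := xiuv j.
apply: lt_trans h1 (le_lt_trans _ h2); rewrite /u /v.
have [->|ne] := eqVneq (lift ord0 i) (widen_ord (leqnSn n) j); first exact: lexx.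
by apply/ltW/y_incr; rewrite ltn_neqAle ne.
Qed.

(** * Positivity and functional equation of Gamma on [[1, +oo[] *)

Section gamma.
Variable R : realType.
Local Notation mu := (@lebesgue_measure R).
Local Notation gamma_integrand p := (fun t : R => t `^ p * expR (- t)).

(** For [p, t > 0] and [u = t / (2 * p)], the bound [ln u <= u] multiplied by [p] gives
    [u ^ p <= exp (t / 2)]. *)
Lemma powR_le_expR (p t : R) : 0 <= p -> 0 <= t ->
  t `^ p <= (2 * p) `^ p * expR (t / 2).
Proof.
rewrite le_eqVlt => /predU1P[<- t0|p0].
  by rewrite !powRr0 mul1r -expR0 ler_expR divr_ge0.
rewrite le_eqVlt => /predU1P[<-|t0].
  by rewrite powR0 ?gt_eqF// mulr_ge0 ?powR_ge0 ?expR_ge0.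
have q0 : 0 < 2 * p by rewrite mulr_gt0.
have -> : t `^ p = (2 * p) `^ p * (t / (2 * p)) `^ p.
  by rewrite -powRM ?divr_ge0 ?ltW// mulrC divfK// gt_eqF.
rewrite ler_pM2l ?powR_gt0// /powR gt_eqF ?divr_gt0// ler_expR.
have -> : t / 2 = p * (t / (2 * p)) by field; rewrite gt_eqF.
rewrite ler_pM2l//.
have u0 : 0 < t / (2 * p) by rewrite divr_gt0.
rewrite -[leRHS](lnK u0); apply: le_trans (expR_ge1Dx _).
by rewrite lerDr.
Qed.

Lemma gamma_integrand_le (p t : R) : 0 <= p -> 0 <= t ->
  t `^ p * expR (- t) <= (2 * p) `^ p * expR (- (t / 2)).
Proof.
move=> p0 t0; rewrite [X in _ * expR (- X)](splitr t) opprD expRD mulrA.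
rewrite ler_pM2r ?expR_gt0// expRN ler_pdivrMr ?expR_gt0//.
exact: powR_le_expR.
Qed.

(** Writing the limit as a power of 0 covers both cases: it is 1 for [p = 0] and 0 for [p > 0]. *)
Lemma powR_cvg_at_right0 (p : R) : 0 <= p ->
  t `^ p @[t --> 0^'+] --> (0 : R) `^ p.
Proof.
rewrite le_eqVlt => /predU1P[<-|p0].
  by under eq_fun do rewrite powRr0; rewrite powRr0; exact: cvg_cst.
by rewrite powR0 ?gt_eqF//; exact: powR_cvg0.
Qed.

Lemma continuous_powR_gt0 (p x : R) : 0 < x -> {for x, continuous (@powR R ^~ p)}.
Proof.
move=> x0; apply: differentiable_continuous; apply/derivable1_diffP.
by apply: derivable_powR; rewrite in_itv/= x0.
Qed.

Lemma continuous_expRZ (c : R) : continuous (fun t : R => expR (c * t)).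
Proof.
move=> x; apply: continuous_comp; last exact: continuous_expR.
by apply: continuousM; [exact: cst_continuous|exact: cvg_id].
Qed.

Lemma within_continuous_gamma_integrand (p : R) : 0 <= p ->
  {within `[0, +oo[, continuous (gamma_integrand p)}.
Proof.
move=> p0; have ce x : {for x, continuous (fun t : R => expR (- t))}.
  by move: (@continuous_expRZ (-1) x); under eq_fun do rewrite mulN1r.
apply/continuous_within_itvcyP; split.
  move=> x; rewrite in_itv/= andbT => x0.
  by apply: cvgM; [exact: continuous_powR_gt0|exact: ce].
apply: cvgM; first exact: powR_cvg_at_right0.
by apply: cvg_at_right_filter; exact: ce.
Qed.

(** For a nonnegative integrand, finiteness of the integral computed from [F] is already
    integrability. *)
Lemma ge0_Rintegral_FTC2y (f F : R -> R) (l : R) :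
  (forall t, 0 <= t -> 0 <= f t) -> {within `[0, +oo[, continuous f} ->
  (forall t : R, 0 < t -> is_derive t 1 F (f t)) ->
  F t @[t --> 0^'+] --> F 0 -> F t @[t --> +oo] --> l ->
  mu.-integrable `]0, +oo[ (EFin \o f) /\
  \int[mu]_(t in `]0, +oo[) f t = l - F 0.
Proof.
move=> f0 cf dF F0 Fl.
have mf : measurable_fun `](0 : R), +oo[ f.
  apply: open_continuous_measurable_fun => //.
  by move: cf => /continuous_within_itvcyP[/in_continuous_mksetP cf _].
have If : (\int[mu]_(t in `]0%R, +oo[) (f t)%:E = l%:E - (F 0)%:E)%E.
  rewrite integral_itv_obnd_cbnd; last exact/measurable_EFinP.
  apply: ge0_continuous_FTC2y => //.
    by move=> t t0; have h := dF t t0; exact: ex_derive.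
  move=> t; rewrite in_itv/= andbT => t0; rewrite derive1E.
  by have h := dF t t0; exact: derive_val.
split; last by rewrite /Rintegral If.
apply/integrableP; split; first exact/measurable_EFinP.
under eq_integral => t.
  rewrite inE/= in_itv/= andbT => /ltW t0; rewrite ger0_norm ?f0//; over.
by rewrite If -EFinB ltry.
Qed.

Lemma cvg_expR_half : expR (- (t / 2)) @[t --> (+oo : set_system R)] --> (0 : R).
Proof.
apply: (@cvg_comp _ _ _ (fun t : R => t / 2)
  (fun t => expR (- t)) _ (pinfty_nbhs R)).
  by apply: gt0_cvgMly.
exact: cvgr_expR.
Qed.

Lemma continuous_expR_half : continuous (fun t : R => expR (- (t / 2))).
Proof.
move=> x; move: (@continuous_expRZ (- 2^-1) x).
by under eq_fun do rewrite mulNr mulrC.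
Qed.

Lemma is_derive_expRZ (c t : R) :
  is_derive t 1 (fun t : R => expR (c * t)) (c * expR (c * t)).
Proof.
rewrite -[X in is_derive _ _ X _]/(expR \o (c *: id)).
by apply: is_derive_eq; rewrite /GRing.scale/= mulr1 mulrC.
Qed.

Lemma is_derive_expR_half (t : R) :
  is_derive t 1 (fun t : R => expR (- (t / 2))) (- expR (- (t / 2)) / 2).
Proof.
have := is_derive_expRZ (- 2^-1) t.
under eq_fun do rewrite mulNr mulrC.
rewrite (_ : - 2^-1 * t = - (t / 2)); last by ring.
by move=> h; apply: is_derive_eq; field.
Qed.

Lemma integral_exp_half :
  mu.-integrable `]0, +oo[ (EFin \o (fun t : R => expR (- (t / 2)))) /\
  \int[mu]_(t in `]0, +oo[) expR (- (t / 2)) = 2.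
Proof.
rewrite [X in _ /\ _ = X](_ : _ = 0 - (- 2 * expR (- (0 / 2)))); last first.
  by rewrite mul0r oppr0 expR0; ring.
apply: (@ge0_Rintegral_FTC2y (fun t => expR (- (t / 2)))
  (fun t => - 2 * expR (- (t / 2)))).
- by move=> t _; exact: expR_ge0.
- by apply: continuous_subspaceT; exact: continuous_expR_half.
- move=> t _; rewrite -[X in is_derive _ _ X _]/(-2 *: (fun t => expR (- (t / 2)))).
  have h := is_derive_expR_half t.
  by apply: is_derive_eq; rewrite /GRing.scale/=; field.
- apply: cvg_at_right_filter; apply: cvgM; first exact: cvg_cst.
  exact: continuous_expR_half.
- rewrite -[X in _ --> X](mulr0 (-2)).
  by apply: cvgM; [exact: cvg_cst|exact: cvg_expR_half].
Qed.

Lemma measurable_gamma_integrand (p : R) : 0 <= p ->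
  measurable_fun `](0 : R), +oo[ (gamma_integrand p).
Proof.
move=> p0; apply: open_continuous_measurable_fun => //.
by move: (within_continuous_gamma_integrand p0)
  => /continuous_within_itvcyP[/in_continuous_mksetP cf _].
Qed.

Lemma integrable_gamma_integrand (p : R) : 0 <= p ->
  mu.-integrable `]0, +oo[ (EFin \o gamma_integrand p).
Proof.
move=> p0; apply: (@le_integrable _ _ _ mu `]0, +oo[ _ _
    (EFin \o (fun t : R => (2 * p) `^ p * expR (- (t / 2))))) => //.
- by apply/measurable_EFinP; exact: measurable_gamma_integrand.
- move=> t/=; rewrite in_itv/= andbT => /ltW t0.
  rewrite lee_fin !ger0_norm; last 2 first.
  - by rewrite mulr_ge0 ?powR_ge0 ?expR_ge0.
  - by rewrite mulr_ge0 ?powR_ge0 ?expR_ge0.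
  exact: gamma_integrand_le.
rewrite (_ : _ \o _ = (fun t => ((2 * p) `^ p)%:E * (expR (- (t / 2)))%:E)%E)//.
by apply: integrableZl => //; exact: (integral_exp_half.1).
Qed.

(** On [[1, 2]] the integrand is at least [exp (-2)], since [t ^ (z - 1) >= 1] there. *)
Lemma Gamma_gt0 (z : R) : 1 <= z -> 0 < Gamma z.
Proof.
move=> z1; have p0 : 0 <= z - 1 by rewrite subr_ge0.
have ip := integrable_gamma_integrand p0.
rewrite -lte_fin /Gamma /Rintegral fineK; last exact: integrable_fin_num.
apply: (@lt_le_trans _ _ (\int[mu]_(t in `[1%R, 2%R]) (expR (-2))%:E)%E).
  have m12 : (0 < mu `[1%R, 2%R])%E.
    rewrite lebesgue_measure_itv/= lte_fin ltr1n -EFinB lte_fin.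
    by rewrite subr_gt0 ltr1n.
  by rewrite integral_cst// mule_gt0// lte_fin expR_gt0.
have sub : `[(1:R), 2]%classic `<=` `]0, +oo[%classic.
  by move=> t/=; rewrite !in_itv/= andbT => /andP[t1 _]; exact: lt_le_trans t1.
apply: (@le_trans _ _
    (\int[mu]_(t in `[1%R, 2%R]) (gamma_integrand (z - 1) t)%:E)%E).
  apply: ge0_le_integral => //.
  - by apply/measurable_EFinP; apply: measurable_funS (measurable_gamma_integrand p0).
  - move=> t/=; rewrite in_itv/= lee_fin => /andP[t1 t2].
    rewrite -[leLHS]mul1r ler_pM ?expR_ge0 ?ler_expR ?lerN2//.
    by rewrite -[leLHS](powRr0 t) ler_powR.
apply: ge0_subset_integral => //.
- by apply/measurable_EFinP; exact: measurable_gamma_integrand.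
- by move=> t _; rewrite lee_fin mulr_ge0 ?powR_ge0 ?expR_ge0.
Qed.

(* The multiple of [exp (- t / 2)] makes the integrand nonnegative, as required
   by the available fundamental theorem of calculus on [0, +oo). *)
Lemma GammaS (z : R) : 1 <= z -> Gamma (z + 1) = z * Gamma z.
Proof.
move=> z1; have p0 : 0 <= z - 1 by rewrite subr_ge0.
have z0 : 0 < z by exact: lt_le_trans z1.
(* This is [z] times the constant of [gamma_integrand_le] for the exponent [z - 1], which makes the
   difference inside [f] nonnegative. *)
pose C : R := z * (2 * (z - 1)) `^ (z - 1).
pose f t := gamma_integrand z t +
  (C * expR (- (t / 2)) - z * gamma_integrand (z - 1) t).
pose F t := - gamma_integrand z t + - (2 * C) * expR (- (t / 2)).
have [|||||fint fE] := @ge0_Rintegral_FTC2y f F 0.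
- move=> t t0; rewrite addr_ge0 ?mulr_ge0 ?powR_ge0 ?expR_ge0// subr_ge0.
  by rewrite -mulrA ler_pM2l//; exact: gamma_integrand_le.
- move=> t; apply: continuousD; first exact: within_continuous_gamma_integrand (ltW z0) t.
  apply: continuousB; apply: continuousM; try exact: cst_continuous.
    exact: (continuous_subspaceT continuous_expR_half).
  exact: within_continuous_gamma_integrand p0 t.
- move=> t t0.
  rewrite -[X in is_derive _ _ X _]/(- ((@powR R ^~ z) * (fun t => expR (- t))) +
    - (2 * C) *: (fun t => expR (- (t / 2)))).
  have h1 := is_derive1_powR z t0.
  have h2 : is_derive t 1 (fun t : R => expR (- t)) (- expR (- t)).
    have := is_derive_expRZ (-1) t.
    by under eq_fun do rewrite mulN1r; rewrite !mulN1r.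
  have h3 := is_derive_expR_half t.
  have h4 := is_deriveD (is_deriveN (is_deriveM h1 h2)) (is_deriveZ (- (2 * C)) h3).
  apply: (is_derive_eq h4); rewrite /f /GRing.scale/=.
  generalize C (t `^ z) (t `^ (z - 1)) (expR (- t)) (expR (- (t / 2))).
  move=> c A B D E. by field.
- apply: cvgD; last first.
    apply: cvgM; first exact: cvg_cst.
    by apply: cvg_at_right_filter; exact: continuous_expR_half.
  apply: cvgN.
  by case/continuous_within_itvcyP: (within_continuous_gamma_integrand (ltW z0)).
- rewrite -[X in _ --> X](addr0 0) -[X in _ --> _ + X](mulr0 (- (2 * C))).
  apply: cvgD; last by apply: cvgM; [exact: cvg_cst|exact: cvg_expR_half].
  rewrite -[X in _ --> X]oppr0; apply: cvgN.
  apply: (@squeeze_cvgr _ _ _ _ (cst 0) (fun t => (2 * z) `^ z * expR (- (t / 2)))).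
  + near=> t; rewrite mulr_ge0 ?powR_ge0 ?expR_ge0//=.
    by apply: gamma_integrand_le; rewrite ?ltW.
  + exact: cvg_cst.
  + rewrite -[X in _ --> X](mulr0 ((2 * z) `^ z)).
    by apply: cvgM; [exact: cvg_cst|exact: cvg_expR_half].
have [i2 e2] := integral_exp_half.
have i1 := integrable_gamma_integrand p0.
have i0 := integrable_gamma_integrand (ltW z0).
have i3 (c : R) (g : R -> R) : mu.-integrable `]0, +oo[ (EFin \o g) ->
    mu.-integrable `]0, +oo[ (EFin \o (fun t => c * g t)).
  by move=> ig; exact: (@integrableZl _ _ R mu _ (measurable_itv _) c (EFin \o g)).
(* As [exp (- t / 2)] has integral 2, [fE] becomes [Gamma (z + 1) + (2 * C - z * Gamma z) = - F 0 =
   2 * C]. *)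
move: fE; rewrite /f RintegralD//; last first.
  by rewrite (_ : _ \o _ = fun t => ((C * expR (- (t / 2)))%:E -
    (z * gamma_integrand (z - 1) t)%:E)%E)//; apply: integrableB => //; exact: i3.
rewrite RintegralB//; [|exact: i3..].
rewrite !RintegralZl// e2 /F /= mul0r oppr0 expR0 mulr1 /Gamma addrK.
rewrite powR0 ?gt_eqF//. lra.
Unshelve. all: by end_near. Qed.

End gamma.

(** * The entire factor of the Bessel function *)

Section bessel_series.
Variable R : realType.

(** The Pochhammer symbol of [s + 1], not of [s]. *)
Definition poch (s : R) (k : nat) : R := \prod_(i < k) (s + i.+1%:R).

(** Coefficients of the hypergeometric series 0F1 with parameter [s + 1]. *)
Definition bessel_coef (s : R) (k : nat) : R := (k`!%:R * poch s k)^-1.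

(* [besselI s x] is [(x / 2) `^ s / Gamma (s + 1)] times the value of this
   entire function at [(x / 2) ^+ 2]. *)
Definition bessel_entire (s y : R) : R := limn (pseries (bessel_coef s) y).

Lemma pochS s k : poch s k.+1 = poch s k * (s + k.+1%:R).
Proof. exact: big_ord_recr. Qed.

Lemma pochS_shift s k : poch s k.+1 = (s + 1) * poch (s + 1) k.
Proof.
rewrite /poch big_ord_recl/=; congr (_ * _); apply: eq_bigr => i _.
by rewrite /bump/= add1n -addrA -[(i.+2)%:R]natr1 [1 + _]addrC.
Qed.

Lemma poch_gt0 s k : 0 <= s -> 0 < poch s k.
Proof. by move=> s0; apply: prodr_gt0 => i _; rewrite ltr_wpDl. Qed.

Lemma poch_ge1 s k : 0 <= s -> 1 <= poch s k.
Proof.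
move=> s0; elim: k => [|k IH]; first by rewrite /poch big_ord0.
by rewrite pochS -[leLHS]mulr1 ler_pM// ler_wpDl// ler1n.
Qed.

Lemma GammaD (s : R) k : 0 <= s -> Gamma (s + k%:R + 1) = Gamma (s + 1) * poch s k.
Proof.
move=> s0; elim: k => [|k IH]; first by rewrite addr0 /poch big_ord0 mulr1.
rewrite -natr1 addrA GammaS ?IH; last by rewrite lerDr addr_ge0.
by rewrite pochS mulrC -addrA natr1 mulrA.
Qed.

Lemma bessel_coef_gt0 s k : 0 <= s -> 0 < bessel_coef s k.
Proof. by move=> s0; rewrite invr_gt0 mulr_gt0 ?poch_gt0// ltr0n fact_gt0. Qed.

(** Since [poch s k >= 1], the exponential series dominates. *)
Lemma is_cvg_bessel_pseries s y : 0 <= s -> cvgn (pseries (bessel_coef s) y).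
Proof.
move=> s0; apply: normed_cvg.
apply: series_le_cvg (is_cvg_series_exp_coeff `|y|) => n.
- exact: normr_ge0.
- by rewrite divr_ge0// exprn_ge0.
- rewrite /= normrM normrX [leRHS]mulrC ler_wpM2r ?exprn_ge0//.
  rewrite gtr0_norm ?bessel_coef_gt0// lef_pV2 ?posrE ?mulr_gt0 ?ltr0n
     ?fact_gt0 ?poch_gt0//.
  by rewrite -[leLHS]mulr1 ler_wpM2l// poch_ge1.
Qed.

Lemma bessel_coef_diffs s : 0 <= s ->
  pseries_diffs (bessel_coef s) = (fun k => (s + 1)^-1 * bessel_coef (s + 1) k).
Proof.
move=> s0; apply/funext => k; rewrite /pseries_diffs /bessel_coef pochS_shift factS natrM.
have := poch_gt0 k (addr_ge0 s0 ler01) => /lt0r_neq0 p0.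
have f0 : (k`!)%:R != 0 :> R by rewrite pnatr_eq0 -lt0n fact_gt0.
have k0 : (k.+1)%:R != 0 :> R by rewrite pnatr_eq0.
have s10 : s + 1 != 0 by rewrite gt_eqF// ltr_wpDl.
move: (k.+1%:R) k0 (k`!%:R) f0 => m k0 l f0.
by field; rewrite p0 f0 k0 s10.
Qed.

Lemma pseriesZ (c : R) (u : nat -> R) y :
  pseries (fun k => c * u k) y = c *: pseries u y.
Proof.
apply/funext => n; rewrite /pseries /series/= -[RHS]/(c * _) mulr_sumr.
by apply: eq_bigr => i _; rewrite mulrA.
Qed.

Lemma is_derive_bessel_entire (s y : R) : 0 <= s ->
  is_derive y 1 (bessel_entire s) ((s + 1)^-1 * bessel_entire (s + 1) y).
Proof.
move=> s0; have s1 : 0 <= s + 1 by rewrite addr_ge0.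
have s2 : 0 <= s + 1 + 1 by rewrite addr_ge0.
have -> : (s + 1)^-1 * bessel_entire (s + 1) y =
    limn (pseries (pseries_diffs (bessel_coef s)) y).
  rewrite bessel_coef_diffs// pseriesZ; apply/esym/cvg_lim => //.
  by apply: cvgMr; exact: is_cvg_bessel_pseries.
(* Termwise differentiation asks for convergence of the series and its first two formal derivatives
   at a point beyond [|y|]. Both derivatives are multiples of series of the same family, of orders
   [s + 1] and [s + 1 + 1]. *)
apply: (@pseries_snd_diffs _ _ (`|y| + 1)).
- exact: is_cvg_bessel_pseries.
- by rewrite bessel_coef_diffs// pseriesZ; apply: is_cvgZr; exact: is_cvg_bessel_pseries.
- rewrite bessel_coef_diffs//.
  rewrite (_ : pseries_diffs _ =
      fun k => (s + 1)^-1 * pseries_diffs (bessel_coef (s + 1)) k); last first.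
    by apply/funext => k; rewrite /pseries_diffs mulrCA.
  rewrite bessel_coef_diffs// !pseriesZ.
  by do 2!apply: is_cvgZr; exact: is_cvg_bessel_pseries.
- by rewrite [ltRHS]ger0_norm ?ltrDl// addr_ge0.
Qed.

Lemma bessel_entire0 s : bessel_entire s 0 = 1.
Proof.
apply/cvg_lim => //; rewrite -cvg_shiftS/=.
rewrite (_ : (fun n => _) = cst 1); first exact: cvg_cst.
apply/funext => n; rewrite /pseries /series/= big_nat_recl// big1 ?addr0.
  by rewrite expr0 mulr1 /bessel_coef fact0 /poch big_ord0 mulr1 invr1.
by move=> i _; rewrite exprS mul0r mulr0.
Qed.

Lemma bessel_entire_gt0 s y : 0 <= s -> 0 <= y -> 0 < bessel_entire s y.
Proof.
move=> s0 y0; apply: (@lt_le_trans _ _ (pseries (bessel_coef s) y 1%N)).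
  rewrite /pseries /series/= big_nat1 expr0 mulr1; exact: bessel_coef_gt0.
apply: nondecreasing_cvgn_le; last exact: is_cvg_bessel_pseries.
apply/nondecreasing_seqP => n; rewrite /pseries /series/= big_nat_recr//= lerDl.
by rewrite mulr_ge0 ?exprn_ge0// ltW// bessel_coef_gt0.
Qed.

(** This is [I_s - I_(s+2) = (2 (s + 1) / x) I_(s+1)] for the entire factors. It is proved on
    coefficients; the factor [y] shifts the partial sums of the last series by one term. *)
Lemma bessel_entire_rec s y : 0 <= s ->
  bessel_entire s y = bessel_entire (s + 1) y +
    y / ((s + 1) * (s + 1 + 1)) * bessel_entire (s + 1 + 1) y.
Proof.
move=> s0; have s1 : 0 <= s + 1 by rewrite addr_ge0.
have s2 : 0 <= s + 1 + 1 by rewrite addr_ge0.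
have c1 := @is_cvg_bessel_pseries _ y s1.
have c2 := @is_cvg_bessel_pseries _ y s2.
apply/cvg_lim => //; rewrite -cvg_shiftS/=.
rewrite (_ : (fun n => _) = (fun n => pseries (bessel_coef (s + 1)) y n.+1 +
    y / ((s + 1) * (s + 1 + 1)) * pseries (bessel_coef (s + 1 + 1)) y n)).
  apply: cvgD; last by apply: cvgMr.
  by rewrite (cvg_shiftS (pseries (bessel_coef (s + 1)) y)).
apply/funext; elim=> [|n IH].
  rewrite /pseries /series/= !big_nat1 big_geq// mulr0 addr0.
  by rewrite /bessel_coef /poch !big_ord0.
move: IH; rewrite /pseries /series/=.
rewrite !big_nat_recr//= => ->.
have -> : bessel_coef s n.+1 = bessel_coef (s + 1) n.+1 +
    ((s + 1) * (s + 1 + 1))^-1 * bessel_coef (s + 1 + 1) n.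
  have e : poch (s + 1) n * (s + 1 + n.+1%:R) = (s + 1 + 1) * poch (s + 1 + 1) n.
    by rewrite -pochS pochS_shift.
  have q0 := lt0r_neq0 (poch_gt0 n s1).
  rewrite /bessel_coef pochS_shift pochS factS natrM.
  have n0 : s + 1 + n.+1%:R != 0 by rewrite gt_eqF// ltr_wpDl.
  have s20 : s + 1 + 1 != 0 by rewrite gt_eqF// ltr_wpDl.
  have s10 : s + 1 != 0 by rewrite gt_eqF// ltr_wpDl.
  have -> : poch (s + 1 + 1) n = poch (s + 1) n * (s + 1 + n.+1%:R) / (s + 1 + 1).
    by rewrite e mulrC mulKf.
  have f0 : (n`!)%:R != 0 :> R by rewrite pnatr_eq0 -lt0n fact_gt0.
  have k0 : (n.+1)%:R != 0 :> R by rewrite pnatr_eq0.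
  move: (n.+1%:R) k0 n0 (n`!%:R) f0 => m k0 n0 l f0.
  by field; rewrite f0 k0 n0 q0 s10 s20.
by rewrite exprS; ring.
Qed.

Lemma besselI_bessel_entire (s x : R) : 0 <= s -> 0 < x ->
  besselI s x = (Gamma (s + 1))^-1 *
    (((x / 2) ^+ 2) `^ (s / 2) * bessel_entire s ((x / 2) ^+ 2)).
Proof.
move=> s0 x0; have h0 : 0 < x / 2 by rewrite divr_gt0.
rewrite mulrA; apply/cvg_lim => //.
rewrite (_ : series _ =
    fun n => ((Gamma (s + 1))^-1 * ((x / 2) ^+ 2) `^ (s / 2)) *
             pseries (bessel_coef s) ((x / 2) ^+ 2) n).
  by apply: cvgMr; exact: is_cvg_bessel_pseries.
apply/funext => n; rewrite /pseries /series/= mulr_sumr; apply: eq_bigr => k _.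
rewrite GammaD// powRD; last by rewrite (gt_eqF h0) implybT.
have -> : (x / 2) `^ s = ((x / 2) ^+ 2) `^ (s / 2).
  by rewrite -powR_mulrn ?ltW// -powRrM mulrCA divff ?pnatr_eq0// mulr1.
rewrite powR_mulrn ?ltW// exprM /bessel_coef !invfM; ring.
Qed.

End bessel_series.

(** * The Riccati system of the Bessel functions, and the conclusion *)

Section bessel_riccati.
Variable R : realType.

Let phi (s y : R) := y `^ (s / 2) * bessel_entire s y.
(** For [0 <= s] this is the derivative of [bessel_entire s]; hence [a] below is the logarithmic
    derivative of [phi] for [y * d/dy]. *)
Let r (s y : R) := (s + 1)^-1 * bessel_entire (s + 1) y.
Let a (s y : R) := s / 2 + y * r s y / bessel_entire s y.

Lemma bessel_riccati_system (n : nat) (s : 'I_n -> R) :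
  (forall i, 0 <= s i) -> injective s ->
  riccati_system id (fun j => s j / 2) (fun j => phi (s j)) (fun j => a (s j)).
Proof.
move=> s0 s_inj.
have cf t : 0 <= t -> bessel_entire t y @[y --> 0^'+] --> (1 : R).
  move=> t0; rewrite -(bessel_entire0 t); apply: cvg_at_right_filter.
  have h := is_derive_bessel_entire 0 t0.
  by apply/differentiable_continuous/derivable1_diffP; exact: ex_derive.
split.
- by move=> j y y0; rewrite mulr_gt0 ?powR_gt0// bessel_entire_gt0// ltW.
- move=> j y y0.
  have h1 := is_derive1_powR (s j / 2) y0.
  have h2 := is_derive_bessel_entire y (s0 j).
  have f0 := lt0r_neq0 (bessel_entire_gt0 (s0 j) (ltW y0)).
  apply: (is_derive_eq (is_deriveM h1 h2)); rewrite /GRing.scale/= /a /phi -/(r (s j) y).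
  rewrite powRB; last by rewrite (gt_eqF y0) implybT.
  rewrite powRr1 ?ltW//; field.
  by rewrite f0 gt_eqF.
- move=> j y y0.
  have s1 : 0 <= s j + 1 by rewrite addr_ge0.
  have f0 := lt0r_neq0 (bessel_entire_gt0 (s0 j) (ltW y0)).
  have h2 := is_derive_bessel_entire y (s0 j).
  have h3 := is_deriveZ (s j + 1)^-1 (is_derive_bessel_entire y s1).
  have h4 := is_deriveM (is_deriveM (is_derive_id y 1) h3) (is_deriveV f0 h2).
  apply: (is_derive_eq (is_deriveD (is_derive_cst (s j / 2) y 1) h4)).
  have s10 : s j + 1 != 0 by rewrite gt_eqF// ltr_wpDl.
  have s20 : s j + 1 + 1 != 0 by rewrite gt_eqF// ltr_wpDl.
  (* Here [f], [g], [h] stand for the entire factors of orders [s j], [s j + 1], [s j + 1 + 1]. The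
     recurrence eliminates [h], which carries the second derivative, and a rational identity
     remains. *)
  have riccati (f g h : R) : f != 0 ->
      f = g + y / ((s j + 1) * (s j + 1 + 1)) * h ->
      y * ((s j + 1)^-1 * g) * (- f ^- 2 * ((s j + 1)^-1 * g)) +
        f^-1 * (y * ((s j + 1)^-1 * ((s j + 1 + 1)^-1 * h)) +
                (s j + 1)^-1 * g * 1) =
      (y + (s j / 2) ^+ 2 - (s j / 2 + y * ((s j + 1)^-1 * g) / f) ^+ 2) / y.
    move=> f0' fE.
    have -> : (s j + 1)^-1 * ((s j + 1 + 1)^-1 * h) = (f - g) / y.
      by rewrite fE; field; rewrite s10 s20 gt_eqF.
    by field; rewrite s10 f0' gt_eqF.
  by rewrite add0r; exact: riccati f0 (bessel_entire_rec y (s0 j)).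
- move=> j; rewrite -[X in _ --> X]addr0; apply: cvgD; first exact: cvg_cst.
  have s1 : 0 <= s j + 1 by rewrite addr_ge0.
  rewrite -[X in _ --> X](_ : 0 * ((s j + 1)^-1 * 1) * 1^-1 = 0); last first.
    by rewrite !mul0r.
  apply: cvgM; last by apply: cvgV; [exact: oner_neq0|exact: cf].
  apply: cvgM; first by apply: cvg_at_right_filter; exact: cvg_id.
  by apply: cvgM; [exact: cvg_cst|exact: cf].
- move=> i j ij.
  rewrite (_ : (fun y => _) = (fun y : R => y `^ (s i / 2) * y `^ (s j / 2) *
      (bessel_entire (s i) y * bessel_entire (s j) y))); last first.
    by apply/funext => y; rewrite /phi mulrACA.
  have p0 (k : 'I_n) : y `^ (s k / 2) @[y --> 0^'+] --> (0 : R) `^ (s k / 2).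
    by apply: powR_cvg_at_right0; rewrite divr_ge0.
  (* Distinct orders are not both 0, so at least one of the powers vanishes even though
     [0 ^ 0 = 1]. *)
  have pp : (0 : R) `^ (s i / 2) * 0 `^ (s j / 2) = 0.
    apply/eqP; rewrite mulf_eq0 !powR_eq0 eqxx/= -negb_and !mulf_eq0 !invr_eq0.
    rewrite pnatr_eq0 !orbF; apply: contra ij => /andP[/eqP si /eqP sj].
    by apply/eqP/s_inj; rewrite si sj.
  rewrite -[X in _ --> X](_ : 0 `^ (s i / 2) * 0 `^ (s j / 2) * (1 * 1) = 0); last first.
    by rewrite pp mul0r.
  by apply: cvgM; apply: cvgM => //; exact: cf.
Qed.

Lemma besselI_det_gt0 (n : nat) (x s : 'I_n -> R) :
  (forall i, 0 < x i) -> (forall i j : 'I_n, (i < j)%N -> x i < x j) ->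
  (forall i, 0 <= s i) -> (forall i j : 'I_n, (i < j)%N -> s i < s j) ->
  0 < \det (\matrix_(i < n, j < n) besselI (s j) (x i)).
Proof.
move=> x0 x_incr s0 s_incr.
have s_inj : injective s.
  move=> i j sij; apply/val_inj; case: (ltngtP i j) => // /s_incr.
    by rewrite sij ltxx.
  by rewrite sij ltxx.
pose y i := (x i / 2) ^+ 2.
(* The Gamma factors depend on the order, that is on the column; transposing turns them into row
   factors. *)
have -> : \matrix_(i, j) besselI (s j) (x i) =
    (\matrix_(j, i) ((Gamma (s j + 1))^-1 * phi (s j) (y i)))^T.
  by apply/matrixP => i j; rewrite !mxE besselI_bessel_entire.
rewrite det_tr det_scale_rows mulr_gt0//.
  by apply: prodr_gt0 => j _; rewrite invr_gt0 Gamma_gt0// lerDr.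
rewrite -det_tr (_ : _^T = \matrix_(i, j) phi (s j) (y i)); last first.
  by apply/matrixP => i j; rewrite !mxE.
apply: (riccati_system_det_gt0 _ _ (bessel_riccati_system s0 s_inj)).
- by move=> i; rewrite divr_ge0.
- by move=> i j ij; rewrite ltr_pM2r ?invr_gt0// s_incr.
- by move=> i; rewrite exprn_gt0// divr_gt0.
- move=> i j ij; rewrite ltr_pXn2r ?nnegrE ?divr_ge0 ?ltW//.
  by rewrite ltr_pM2r ?invr_gt0// x_incr.
Qed.

End bessel_riccati.

Theorem theorem1p1 (R : realType) :
  (forall (m : nat) (x s : 'I_m -> R),
     (1 <= m)%N ->
     (forall i : 'I_m, 0 < x i) ->
     (forall i j : 'I_m, (i < j)%N -> x i < x j) ->
     (forall i : 'I_m, 0 <= s i) ->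
     (forall i j : 'I_m, (i < j)%N -> s i < s j) ->
     0 < \det (\matrix_(i < m, j < m) besselI (s j) (x i)))
  /\ STPoo [set x : R | 0 < x] [set s : R | 0 <= s]
       (fun x s : R => besselI s x).
Proof.
have H m (x s : 'I_m -> R) := @besselI_det_gt0 R m x s.
split=> [m x s _ x0 x_incr s0 s_incr | m x s _ x0 s0 x_incr s_incr]; exact: H.
Qed.
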